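(* Let $\kappa>0$. Let $\mu$ be a distribution over $[q]^E$ ($E$ finite) with support $\Omega$, and let $Q$ be a reversible Markov chain on $\Omega$ with stationary distribution $\mu$. Suppose there exists a family of transport flows $\{\Gamma_e^{a\to b}\}$, where $\Gamma_e^{a\to b}$ is a transport flow (w.r.t. $Q$) from $\mu^{e\gets a}$ to $\mu^{e\gets b}$, for all $e\in E$ and $a,b\in\Omega(\mu_e)$ with $a<b$, satisfying the strong $\kappa$-expected congestion condition: for every transition $(x\mapsto y)$ and all $a,b\in[q]$ with $a<b$, $$\sum_{e\in E:\,a,b\in\Omega(\mu_e)}\mu_e(a)\mu_e(b)\,\mathbb{E}_{\gamma\sim\Gamma_e^{a\to b}}\left[\ell(\gamma)\mathbf{1}[(x\mapsto y)\in\gamma]\right]\le\kappa\,\mu(x)Q(x,y).$$ Let $\phi>0$ satisfy $\phi\le\min\{\mu_e(c):e\in E,c\in[q],\mu_e(c)\ne0\}$. Then $Q$ satisfies the $\alpha$-local log-Sobolev inequality with $$\alpha=\frac{1}{2q^2\kappa}\cdot\frac{1-2\phi}{\log(\frac1\phi-1)},$$ i.e. for all $f:\Omega\to\mathbb{R}$, with $X\sim\mu$ and $F=f(X)$, $\alpha\sum_{e\in E}\mathrm{Ent}(\mathbb{E}[F^2\mid X_e])\le\mathcal{E}_Q(f,f)$.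
   Context: $[q]=\{0,\dots,q-1\}$; $\mu_e$ is the marginal of $\mu$ on $e$, $\Omega(\cdot)$ denotes support, and $\mu^{e\gets c}$ is $\mu$ conditioned on $X_e=c$. A path in the transition graph of $Q$ is a sequence $\gamma=(x_0,\dots,x_\ell)$ with $Q(x_i,x_{i+1})>0$ for $i<\ell$; $\ell(\gamma)=\ell$, $s(\gamma)=x_0$, $t(\gamma)=x_\ell$; a transition is $(x\mapsto y)$ with $Q(x,y)>0$, and $(x\mapsto y)\in\gamma$ means $x=x_i,y=x_{i+1}$ for some $i<\ell$. A transport flow from $\nu$ to $\pi$ is a distribution over such paths with $s(\gamma)\sim\nu$, $t(\gamma)\sim\pi$. $\mathrm{Ent}(G)=\mathbb{E}[G\log G]-\mathbb{E}G\log\mathbb{E}G$; $\mathcal{E}_Q(f,f)=\frac12\sum_{x,y}\mu(x)Q(x,y)(f(x)-f(y))^2$. *)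

(* Defs.v *)
From HB Require Import structures.
From mathcomp Require Import all_boot all_order all_algebra.
From mathcomp Require Import all_classical all_reals ereal esum exp.
Set Implicit Arguments.
Unset Strict Implicit.
Unset Printing Implicit Defensive.
Import Order.TTheory GRing.Theory Num.Theory.
Local Open Scope classical_set_scope.
Local Open Scope ring_scope.

Definition supp (R : realType) (T : Type) (p : T -> R) : pred T :=
  fun x => p x != 0.

Definition is_fdist (R : realType) (T : finType) (p : T -> R) : Prop :=
  (forall x, 0 <= p x) /\ \sum_x p x = 1.

(* Paths have unbounded length, so a distribution over paths lives on an
   infinite countable type; esum is the unordered sum in \bar R, which is the
   intended one for the nonnegative families summed below. *)
Definition is_dist (R : realType) (T : choiceType) (p : T -> R) : Prop :=
  (forall x, 0 <= p x) /\ \esum_(x in [set: T]) (p x)%:E = 1%E.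

(* Only meaningful for a nonnegative X; the value may be +oo. *)
Definition nnexpect (R : realType) (T : choiceType) (p : T -> R) (X : T -> R) :
  \bar R := \esum_(x in [set: T]) (p x * X x)%:E.

Definition config (E : finType) (q : nat) : finType := {ffun E -> 'I_q}.

Definition Omega (R : realType) (E : finType) (q : nat)
    (mu : config E q -> R) : finType := {x : config E q | supp mu x}.

Definition marginal (R : realType) (E : finType) (q : nat)
    (mu : config E q -> R) (e : E) (c : 'I_q) : R :=
  \sum_(x : config E q | x e == c) mu x.

(* The law of X given X_e = c, as a function on Omega; it is a probability
   distribution when c is in the support of the marginal at e. *)
Definition pin (R : realType) (E : finType) (q : nat)
    (mu : config E q -> R) (e : E) (c : 'I_q) (x : Omega mu) : R :=
  if val x e == c then mu (val x) / marginal mu e c else 0.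

(* Detailed balance makes mu stationary for Q. *)
Definition reversible_chain (R : realType) (E : finType) (q : nat)
    (mu : config E q -> R) (Q : Omega mu -> Omega mu -> R) : Prop :=
  [/\ forall x y, 0 <= Q x y,
      forall x, \sum_y Q x y = 1 &
      forall x y, mu (val x) * Q x y = mu (val y) * Q y x].

Definition transition (R : realType) (S : finType) (Q : S -> S -> R) : rel S :=
  fun x y => 0 < Q x y.

(* The pair (x_0, [:: x_1; ...; x_l]) encodes the path (x_0, ..., x_l). *)
Definition qpath (R : realType) (S : finType) (Q : S -> S -> R) : choiceType :=
  {g : S * seq S | path (transition Q) g.1 g.2}.

Definition path_source (R : realType) (S : finType) (Q : S -> S -> R)
    (g : qpath Q) : S := (val g).1.

Definition path_target (R : realType) (S : finType) (Q : S -> S -> R)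
    (g : qpath Q) : S := last (val g).1 (val g).2.

Definition path_length (R : realType) (S : finType) (Q : S -> S -> R)
    (g : qpath Q) : nat := size (val g).2.

(* The zip is the list of consecutive pairs (x_i, x_{i+1}), i < l. *)
Definition traverses (R : realType) (S : finType) (Q : S -> S -> R)
    (x y : S) (g : qpath Q) : bool :=
  (x, y) \in zip ((val g).1 :: (val g).2) (val g).2.

Definition transport_flow (R : realType) (S : finType) (Q : S -> S -> R)
    (nu pi : S -> R) (G : qpath Q -> R) : Prop :=
  [/\ is_dist G,
      forall x, \esum_(g in [set g | path_source g = x]) (G g)%:E = (nu x)%:E &
      forall x, \esum_(g in [set g | path_target g = x]) (G g)%:E = (pi x)%:E].

Definition transport_flow_family (R : realType) (E : finType) (q : nat)
    (mu : config E q -> R) (Q : Omega mu -> Omega mu -> R)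
    (G : E -> 'I_q -> 'I_q -> qpath Q -> R) : Prop :=
  forall (e : E) (a b : 'I_q),
    supp (marginal mu e) a -> supp (marginal mu e) b -> (a < b)%N ->
    transport_flow (@pin R E q mu e a) (@pin R E q mu e b) (G e a b).

Definition strong_expected_congestion (R : realType) (E : finType) (q : nat)
    (mu : config E q -> R) (Q : Omega mu -> Omega mu -> R)
    (G : E -> 'I_q -> 'I_q -> qpath Q -> R) (kappa : R) : Prop :=
  forall (x y : Omega mu), transition Q x y ->
  forall (a b : 'I_q), (a < b)%N ->
  (\sum_(e : E | supp (marginal mu e) a && supp (marginal mu e) b)
     (marginal mu e a * marginal mu e b)%:E *
     nnexpect (G e a b)
       (fun g => (path_length g)%:R * (traverses x y g)%:R)%R
   <= (kappa * mu (val x) * Q x y)%:E)%E.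

Definition expect (R : realType) (E : finType) (q : nat)
    (mu : config E q -> R) (G : Omega mu -> R) : R :=
  \sum_(x : Omega mu) mu (val x) * G x.

(* E[G | X_e], as a random variable on Omega. *)
Definition cond_expect (R : realType) (E : finType) (q : nat)
    (mu : config E q -> R) (e : E) (G : Omega mu -> R) (x : Omega mu) : R :=
  (\sum_(y : Omega mu | val y e == val x e) mu (val y) * G y)
    / marginal mu e (val x e).

(* ln 0 = 0, so that 0 log 0 = 0 as usual. *)
Definition Ent (R : realType) (E : finType) (q : nat)
    (mu : config E q -> R) (G : Omega mu -> R) : R :=
  expect (fun x => G x * ln (G x)) - expect G * ln (expect G).

Definition dirichlet (R : realType) (E : finType) (q : nat)
    (mu : config E q -> R) (Q : Omega mu -> Omega mu -> R)
    (f : Omega mu -> R) : R :=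
  2^-1 * \sum_(x : Omega mu) \sum_(y : Omega mu)
           mu (val x) * Q x y * (f x - f y) ^+ 2.

Definition local_log_sobolev (R : realType) (E : finType) (q : nat)
    (mu : config E q -> R) (Q : Omega mu -> Omega mu -> R) (alpha : R) : Prop :=
  forall f : Omega mu -> R,
    alpha * \sum_(e : E) Ent (cond_expect e (fun x => f x ^+ 2))
      <= dirichlet Q f.

(* (1 - 2 phi) / log (1/phi - 1). At phi = 1/2 the quotient is 0/0 and is read
   as its limit 1/2, the usual convention for this log-Sobolev constant. At
   phi = 1, ln 0 = 0 and division by 0 give 0, which is again the limit. *)
Definition lsi_ratio (R : realType) (phi : R) : R :=
  if phi == 2^-1 then 2^-1 else (1 - 2 * phi) / ln (phi^-1 - 1).

(* Main.v *)
(** Write u_c for the L^2 norm of f under mu^{e<-c}. The law of f(X)^2 given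
    X_e is u_{X_e}^2, and Ent(u^2) is at most 2/lsi_ratio(phi) times Var(u): by
    the variational formula Ent(u^2) <= E[u^2 ln(u^2/m^2) - u^2 + m^2] with
    m = E u, this reduces to a one-variable inequality in t = u/m, where
    0 <= t <= 1/phi because every atom of mu_e has mass at least phi. This is
    twice the sharp constant, which is affordable because
    Var(u) = sum_{a<b} mu_e(a) mu_e(b) (u_a - u_b)^2 is a sum over at most
    q^2/2 pairs. Each term is estimated by Minkowski's inequality for the
    coupling of the two endpoints of a random path of the transport flow,
    Cauchy-Schwarz along the path, and the congestion condition. *)
Require Import Defs.
From HB Require Import structures.
From mathcomp Require Import all_boot all_order all_algebra.
From mathcomp Require Import all_classical all_reals ereal esum exp.
From mathcomp Require Import normedtype derive realfun ring lra.
Set Implicit Arguments.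
Unset Strict Implicit.
Unset Printing Implicit Defensive.
Import Order.TTheory GRing.Theory Num.Theory.
Import numFieldNormedType.Exports.
Local Open Scope ring_scope.

(** * Bounds on the logarithm and the one-variable inequality *)

Lemma ge1_derive_ge0_le (R : realType) (g dg : R -> R) :
  (forall x : R, 1 <= x -> is_derive x 1 g (dg x)) ->
  (forall x : R, 1 <= x -> 0 <= dg x) ->
  forall t : R, 1 <= t -> g 1 <= g t.
Proof.
move=> Dg dg0 t t1.
have [x||x] := @MVT_segment R g dg 1 t t1.
- by rewrite in_itv/= => /andP[/ltW x1 _]; exact: Dg.
- apply: derivable_within_continuous => x; rewrite in_itv/= => /andP[x1 _].
  by apply: ex_derive; exact: Dg.
- rewrite in_itv/= => /andP[x1 _] e; rewrite -subr_ge0 e.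
  by rewrite mulr_ge0 ?subr_ge0 ?dg0.
Qed.

(** Both sides vanish at 1, and the gap has derivative [(x - 1)^2 / (2 x^2)]. *)
Lemma ln_le_half_subV (R : realType) (t : R) : 1 <= t -> ln t <= (t - t^-1) / 2.
Proof.
move=> t1; rewrite -subr_ge0.
pose g (x : R) := (x - x^-1) / 2 - ln x.
have := @ge1_derive_ge0_le R g (fun x => (1 + x^-2) / 2 - x^-1) _ _ t t1.
rewrite /g invr1 subrr mul0r ln1 subr0; apply => x x1.
  have x0 : 0 < x by lra.
  have xn0 : x != 0 by rewrite gt_eqF.
  have dV := is_deriveV (f := id) xn0 (is_derive_id x 1).
  have dg := is_deriveB (is_deriveM (is_deriveB (is_derive_id x 1) dV)
    (is_derive_cst (2^-1 : R) x 1)) (is_derive1_ln x0).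
  apply: is_derive_eq dg _.
  by rewrite /GRing.scale/= /cst ?mulr0; field.
have x0 : 0 < x by lra.
suff -> : (1 + x^-2) / 2 - x^-1 = (x - 1) ^+ 2 / (2 * x ^+ 2).
  by rewrite divr_ge0 ?sqr_ge0// mulr_ge0// sqr_ge0.
by field; rewrite gt_eqF.
Qed.

(** The lower bound is the first Padé approximant at 1; the gap has derivative
    [(x - 1)^2 / (x (x + 1)^2)]. *)
Lemma ln_ge_pade (R : realType) (t : R) : 1 <= t -> 2 * (t - 1) / (t + 1) <= ln t.
Proof.
move=> t1; rewrite -subr_ge0.
pose g (x : R) := ln x - 2 + 4 * (x + 1)^-1.
have := @ge1_derive_ge0_le R g (fun x => x^-1 - 4 * (x + 1) ^- 2) _ _ t t1.
rewrite /g ln1.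
have -> : 0 - 2 + 4 * (1 + 1)^-1 = 0 :> R by field.
have -> : ln t - 2 + 4 * (t + 1)^-1 = ln t - 2 * (t - 1) / (t + 1).
  by field; rewrite gt_eqF//; lra.
apply => x x1.
  have x0 : 0 < x by lra.
  have xn0 : x + 1 != 0 by rewrite gt_eqF//; lra.
  have dV := is_deriveV (f := fun y => y + 1) xn0
    (is_deriveD (is_derive_id x 1) (is_derive_cst (1 : R) x 1)).
  have dg := is_deriveD (is_deriveB (is_derive1_ln x0) (is_derive_cst (2 : R) x 1))
    (is_deriveM (is_derive_cst (4 : R) x 1) dV).
  apply: is_derive_eq dg _.
  by rewrite /GRing.scale/= /cst ?mulr0; field; rewrite xn0/= gt_eqF.
have x0 : 0 < x by lra.
suff -> : x^-1 - 4 * (x + 1)^-2 = (x - 1) ^+ 2 / (x * (x + 1) ^+ 2).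
  by rewrite divr_ge0 ?sqr_ge0// mulr_ge0 ?sqr_ge0// ltW.
by field; rewrite !gt_eqF//; lra.
Qed.

Lemma ln_ratio_ge2 (R : realType) (T : R) : 2 < T -> 2 <= T * ln (T - 1) / (T - 2).
Proof.
move=> T2; have T1 : 1 <= T - 1 by lra.
have := ln_ge_pade T1; rewrite (_ : T - 1 + 1 = T); last by ring.
rewrite ler_pdivrMr; last by lra.
rewrite ler_pdivlMr; last by lra.
by lra.
Qed.

(** At [T = 1 / phi] this function of [T] is [1 / lsi_ratio phi]; monotonicity passes from the
    constant for [T = t] to the one for any [phi <= 1 / t]. *)
Lemma ln_ratio_incr (R : realType) (x y : R) : 2 < x -> x <= y ->
  x * ln (x - 1) / (x - 2) <= y * ln (y - 1) / (y - 2).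
Proof.
move=> x2 xy; rewrite ler_pdivrMr; last by lra.
rewrite mulrAC ler_pdivlMr; last by lra.
have [a ax] : {a | x = a + 1} by exists (x - 1); ring.
have [b bx] : {b | y = b + 1} by exists (y - 1); ring.
have a1 : 1 < a by lra.
have ab : a <= b by lra.
have a0 : 0 < a by lra.
have b0 : 0 < b by lra.
rewrite ax bx !addrK {x y x2 xy ax bx}.
have La := ln_le_half_subV (ltW a1).
have Lb : 2 * (b - a) / (a + b) <= ln b - ln a.
  rewrite -ln_div ?posrE//.
  have ba1 : 1 <= b / a by rewrite ler_pdivlMr// mul1r.
  apply: le_trans (ln_ge_pade ba1).
  by rewrite le_eqVlt; apply/orP; left; apply/eqP; field; rewrite !gt_eqF//; lra.
move: (ln a) (ln b) La Lb => la lb La Lb.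
(* The cross-multiplied claim, regrouped so that [ln a] needs only an upper bound and [ln b - ln a]
   only a lower one. *)
suff : 2 * (b - a) * la <= (b + 1) * (a - 1) * (lb - la) by lra.
apply: (@le_trans _ _ (2 * (b - a) * ((a - a^-1) / 2))).
  by apply: ler_wpM2l La; lra.
apply: (@le_trans _ _ ((b + 1) * (a - 1) * (2 * (b - a) / (a + b)))); last first.
  by apply: ler_wpM2l Lb; rewrite mulr_ge0//; lra.
rewrite -subr_ge0.
have -> : (b + 1) * (a - 1) * (2 * (b - a) / (a + b)) - 2 * (b - a) * ((a - a^-1) / 2)
  = (b - a) ^+ 2 * (a - 1) ^+ 2 / (a * (a + b)).
  by field; rewrite !gt_eqF//; lra.
by rewrite divr_ge0// mulr_ge0 ?sqr_ge0//; lra.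
Qed.

(** The constant 4 is twice 2, the least value of [1 / lsi_ratio phi] for [phi <= 1/2], so this
    range is settled uniformly in [phi]. *)
Lemma sqr_ln_le_small (R : realType) (t : R) : 0 <= t <= 4 ->
  2 * t ^+ 2 * ln t - t ^+ 2 + 1 <= 4 * (t - 1) ^+ 2.
Proof.
move=> /andP[]; rewrite le_eqVlt => /orP[/eqP <- _|t0 t4].
  by rewrite expr0n/= mulr0 mul0r; lra.
case: (leP t 1) => t1.
  have := @le_ln1Dx R (t - 1); rewrite addrCA subrr addr0 => /(_ _) L.
  have {}L : ln t <= t - 1 by apply: L; lra.
  have : t ^+ 2 * ln t <= t ^+ 2 * (t - 1) by rewrite ler_wpM2l// sqr_ge0.
  suff : 0 <= (1 - t) ^+ 2 * (3 - 2 * t) by lra.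
  by rewrite mulr_ge0 ?sqr_ge0//; lra.
(* The bound on ln is applied to sqrt t: applied to t it only covers t <= 3. *)
pose w := Num.sqrt t.
have w1 : 1 <= w by rewrite -sqrtr1 ler_wsqrtr// ltW.
have w2 : w <= 2.
  have -> : 2 = Num.sqrt (2 ^+ 2) :> R by rewrite sqrtr_sqr ger0_norm.
  by rewrite ler_wsqrtr//; lra.
have tw : t = w ^+ 2 by rewrite sqr_sqrtr// ltW.
have L := ln_le_half_subV w1.
rewrite tw lnXn; last by lra.
have : w ^+ 4 * ln w <= w ^+ 4 * ((w - w^-1) / 2).
  by rewrite ler_wpM2l// exprn_ge0//; lra.
have -> : w ^+ 4 * ((w - w^-1) / 2) = (w ^+ 5 - w ^+ 3) / 2.
  by field; rewrite gt_eqF//; lra.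
(* This is the gap once [ln w] is replaced by its bound; its last factor is positive because
   [w <= 2]. *)
suff : 0 <= (w ^+ 2 - 1) * (w - 1) * (3 + 3 * w - 2 * w ^+ 2).
  by rewrite -[ln w *+ 2]mulr_natl; lra.
have : 0 <= (w - 1) * (2 - w) by rewrite mulr_ge0//; lra.
have : 0 <= (w - 1) * (w + 1) by rewrite mulr_ge0//; lra.
by move=> *; rewrite !mulr_ge0//; lra.
Qed.

(** The constant is the one for [phi = 1 / t], the extreme case of [t <= 1 / phi]. *)
Lemma sqr_ln_le_large (R : realType) (t : R) : 4 <= t ->
  2 * t ^+ 2 * ln t - t ^+ 2 + 1 <= 2 * (t * ln (t - 1) / (t - 2)) * (t - 1) ^+ 2.
Proof.
move=> t4; have t1 : 0 < t - 1 by lra.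
have t2 : 0 < t - 2 by lra.
have L1 : ln t <= ln (t - 1) + (t - 1)^-1.
  rewrite -lerBlDl -ln_div ?posrE//; last by lra.
  have -> : t / (t - 1) = 1 + (t - 1)^-1 by field; rewrite gt_eqF.
  by apply: le_ln1Dx; apply: lt_trans (_ : 0 < _); rewrite ?oppr_lt0// invr_gt0.
have l0 : 0 <= ln t by rewrite ln_ge0//; lra.
apply: (@le_trans _ _ (2 * (t * (ln t - (t - 1)^-1) / (t - 2)) * (t - 1) ^+ 2)); last first.
  have ? : 0 <= (t - 2)^-1 by rewrite invr_ge0 ltW.
  by rewrite ler_wpM2r ?sqr_ge0// ler_wpM2l// ler_wpM2r// ler_wpM2l//; lra.
rewrite -subr_ge0.
(* The gap is now explicit, and [t^2 - 3 t - 2 = t (t - 4) + (t - 2)] is positive for [t >= 4]. *)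
have -> : 2 * (t * (ln t - (t - 1)^-1) / (t - 2)) * (t - 1) ^+ 2
    - (2 * t ^+ 2 * ln t - t ^+ 2 + 1)
  = (2 * t * ln t + (t - 1) * (t ^+ 2 - 3 * t - 2)) / (t - 2).
  by field; rewrite !gt_eqF.
rewrite divr_ge0//; last by lra.
have : 0 <= t * (t - 4) by rewrite mulr_ge0//; lra.
by move=> ?; rewrite addr_ge0// mulr_ge0//; lra.
Qed.

Lemma lsi_ratio_half (R : realType) : lsi_ratio (2^-1 : R) = 2^-1.
Proof. by rewrite /lsi_ratio eqxx. Qed.

Lemma lsi_ratio_inv (R : realType) (phi : R) : 0 < phi < 2^-1 ->
  (lsi_ratio phi)^-1 = phi^-1 * ln (phi^-1 - 1) / (phi^-1 - 2).
Proof.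
move=> /andP[p0 p2]; rewrite /lsi_ratio lt_eqF// invf_div.
have -> : 1 - 2 * phi = phi * (phi^-1 - 2) by field; rewrite gt_eqF.
by rewrite invfM mulrA [_ / phi]mulrC.
Qed.

Lemma lsi_ratio_inv_ge2 (R : realType) (phi : R) : 0 < phi <= 2^-1 ->
  2 <= (lsi_ratio phi)^-1.
Proof.
move=> /andP[p0]; rewrite le_eqVlt => /orP[/eqP ->|p2].
  by rewrite lsi_ratio_half invrK.
rewrite lsi_ratio_inv ?p0//; apply: ln_ratio_ge2.
by rewrite -[2]invrK ltf_pV2 ?posrE.
Qed.

Lemma sqr_ln_le (R : realType) (phi t : R) : 0 < phi <= 2^-1 -> 0 <= t <= phi^-1 ->
  2 * t ^+ 2 * ln t - t ^+ 2 + 1 <= 2 / lsi_ratio phi * (t - 1) ^+ 2.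
Proof.
move=> hp /andP[t0 tp]; have K2 := lsi_ratio_inv_ge2 hp.
case: (leP t 4) => t4.
  apply: le_trans (sqr_ln_le_small _) _; first by rewrite t0 t4.
  by rewrite ler_wpM2r ?sqr_ge0//; lra.
apply: le_trans (sqr_ln_le_large (ltW t4)) _.
(* [phi = 1/2] would force [t <= 2], against [4 < t]. *)
have p2 : 0 < phi < 2^-1.
  case/andP: hp => -> /=; rewrite le_eqVlt => /orP[/eqP e|//].
  by move: tp; rewrite e invrK; lra.
rewrite ler_wpM2r ?sqr_ge0// ler_wpM2l// lsi_ratio_inv//.
by apply: ln_ratio_incr => //; lra.
Qed.

Lemma sqr_ln_div_le (R : realType) (phi m u : R) : 0 < phi <= 2^-1 ->
  0 < m -> 0 <= u -> phi * u <= m ->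
  u ^+ 2 * ln (u ^+ 2) - u ^+ 2 * ln (m ^+ 2) - u ^+ 2 + m ^+ 2
    <= 2 / lsi_ratio phi * (u - m) ^+ 2.
Proof.
move=> hp m0 u0 um; have p0 : 0 < phi by case/andP: hp.
have tp : 0 <= u / m <= phi^-1.
  by rewrite divr_ge0 ?(ltW m0)//= ler_pdivrMr// mulrC ler_pdivlMr// mulrC.
have := sqr_ln_le hp tp; move: (2 / lsi_ratio phi) => K H.
have m2 : 0 <= m ^+ 2 by rewrite sqr_ge0.
have := ler_wpM2l m2 H.
have -> : m ^+ 2 * (K * (u / m - 1) ^+ 2) = K * (u - m) ^+ 2.
  by field; rewrite gt_eqF.
apply: le_trans; rewrite le_eqVlt; apply/orP; left; apply/eqP.
move: u0; rewrite le_eqVlt => /orP[/eqP <-|u0].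
  by rewrite !mul0r expr0n/= !(mulr0, mul0r, subr0, add0r, oppr0, mulr1).
rewrite ln_div ?posrE// !lnXn// -![ln _ *+ 2]mulr_natl.
by field; rewrite gt_eqF.
Qed.

(** * Entropy, variance and sums over pairs *)

(** The last hypothesis compares [u] with its mean instead of bounding the atoms of [p]: in the
    application [p] lives on configurations, whose masses may be below [phi], while [u] depends on
    one coordinate. *)
Lemma entropy_sqr_le_variance (R : realType) (I : finType) (p u : I -> R) (phi : R) :
  is_fdist p -> (forall x, 0 <= u x) -> 0 < phi <= 2^-1 ->
  (forall x, phi * u x <= \sum_y p y * u y) ->
  \sum_x p x * (u x ^+ 2 * ln (u x ^+ 2))
    - (\sum_x p x * u x ^+ 2) * ln (\sum_x p x * u x ^+ 2)
  <= 2 / lsi_ratio phi * (\sum_x p x * u x ^+ 2 - (\sum_x p x * u x) ^+ 2).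
Proof.
move=> [p0 p1] u0 hp um.
set m := \sum_x p x * u x in um *; set S := \sum_x p x * u x ^+ 2.
have phi0 : 0 < phi by case/andP: hp.
have m0 : 0 <= m by apply: sumr_ge0 => x _; exact: mulr_ge0.
have varE : \sum_x p x * (u x - m) ^+ 2 = S - m ^+ 2.
  transitivity (\sum_x (p x * u x ^+ 2 - 2 * m * (p x * u x) + m ^+ 2 * p x)).
    by apply: eq_bigr => x _; ring.
  rewrite big_split/= sumrB -!mulr_sumr p1 -/m -/S; ring.
have varS : m ^+ 2 <= S.
  by rewrite -subr_ge0 -varE sumr_ge0// => x _; rewrite mulr_ge0// sqr_ge0.
move: m0; rewrite le_eqVlt => /orP[/eqP m0|m0].
  have uz x : u x = 0.
    by apply/le_anti; rewrite u0 andbT -(pmulr_rle0 _ phi0) m0.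
  have -> : S = 0 by rewrite /S big1// => x _; rewrite uz expr0n/= mulr0.
  rewrite -m0 mul0r expr0n/= !subr0 mulr0 big1// => x _.
  by rewrite uz expr0n/= mul0r mulr0.
have m20 : 0 < m ^+ 2 by rewrite exprn_gt0.
have S0 : 0 < S by exact: lt_le_trans varS.
(* The variational step: [ln r <= r - 1] at [r = m^2 / S] replaces the reference value [S] by
   [m^2]. *)
have LS : S * ln (m ^+ 2) - S * ln S <= m ^+ 2 - S.
  rewrite -mulrBr -ln_div ?posrE//.
  have := @le_ln1Dx R (m ^+ 2 / S - 1); rewrite addrCA subrr addr0 => /(_ _) L.
  have {}L : ln (m ^+ 2 / S) <= m ^+ 2 / S - 1.
    by apply: L; have : 0 < m ^+ 2 / S; [rewrite divr_gt0|lra].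
  have := ler_wpM2l (ltW S0) L; rewrite mulrBr mulr1 mulrCA divff ?mulr1//.
  by rewrite gt_eqF.
rewrite -varE mulr_sumr.
have : \sum_x p x * (u x ^+ 2 * ln (u x ^+ 2) - u x ^+ 2 * ln (m ^+ 2) - u x ^+ 2 + m ^+ 2)
    <= \sum_x 2 / lsi_ratio phi * (p x * (u x - m) ^+ 2).
  apply: ler_sum => x _; rewrite [leRHS]mulrCA; apply: ler_wpM2l => //.
  exact: sqr_ln_div_le.
apply: le_trans.
have -> : \sum_x p x * (u x ^+ 2 * ln (u x ^+ 2) - u x ^+ 2 * ln (m ^+ 2) - u x ^+ 2 + m ^+ 2)
  = \sum_x p x * (u x ^+ 2 * ln (u x ^+ 2)) - S * ln (m ^+ 2) - S + m ^+ 2.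
  transitivity (\sum_x (p x * (u x ^+ 2 * ln (u x ^+ 2))
      - p x * u x ^+ 2 * ln (m ^+ 2) - p x * u x ^+ 2 + m ^+ 2 * p x)).
    by apply: eq_bigr => x _; ring.
  by rewrite big_split/= !sumrB -!mulr_sumr -mulr_suml p1 -/S mulr1.
by lra.
Qed.

(** The sum over all ordered pairs counts each unordered pair twice and has zero diagonal; expanding
    the square shows that it is twice the variance. *)
Lemma variance_pairs (R : realType) (q : nat) (p v : 'I_q -> R) : \sum_a p a = 1 ->
  \sum_a p a * v a ^+ 2 - (\sum_a p a * v a) ^+ 2
  = \sum_(a : 'I_q) \sum_(b : 'I_q | (a < b)%N) p a * p b * (v a - v b) ^+ 2.
Proof.
move=> p1; set V := RHS.
have VV : \sum_a \sum_b p a * p b * (v a - v b) ^+ 2 = V + V.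
  transitivity (\sum_(a : 'I_q) (\sum_(b : 'I_q | (a < b)%N) p a * p b * (v a - v b) ^+ 2
      + \sum_(b : 'I_q | (b < a)%N) p a * p b * (v a - v b) ^+ 2)).
    apply: eq_bigr => a _; rewrite (bigID (fun b : 'I_q => (a < b)%N))/=; congr (_ + _).
    rewrite (bigD1 a) ?ltnn//= subrr expr0n mulr0 add0r.
    by apply: eq_bigl => b; rewrite -leqNgt ltn_neqAle andbC.
  rewrite big_split/=; congr (_ + _).
  rewrite /V (exchange_big_dep predT)//=.
  by apply: eq_bigr => a _; apply: eq_bigr => b _; ring.
suff : \sum_a \sum_b p a * p b * (v a - v b) ^+ 2
    = 2 * (\sum_a p a * v a ^+ 2 - (\sum_a p a * v a) ^+ 2) by rewrite VV; lra.
set S := \sum_a p a * v a ^+ 2; set m := \sum_a p a * v a.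
transitivity (\sum_a (p a * v a ^+ 2 - 2 * m * (p a * v a) + S * p a)).
  apply: eq_bigr => a _.
  transitivity (\sum_b (p a * v a ^+ 2 * p b - 2 * (p a * v a) * (p b * v b)
     + p a * (p b * v b ^+ 2))).
    by apply: eq_bigr => b _; ring.
  by rewrite big_split/= sumrB -!mulr_sumr p1 -/S -/m; ring.
by rewrite big_split/= sumrB -!mulr_sumr p1 -/S -/m; ring.
Qed.

(** * Cauchy-Schwarz along paths and Minkowski for couplings *)

(** Cauchy-Schwarz against the constant 1, obtained by expanding the nonnegative double sum of
    [(d z - d w)^2]. *)
Lemma sqr_sum_le_size (R : realType) (T : Type) (s : seq T) (d : T -> R) :
  (\sum_(z <- s) d z) ^+ 2 <= (size s)%:R * \sum_(z <- s) d z ^+ 2.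
Proof.
have : 0 <= \sum_(z <- s) \sum_(w <- s) (d z - d w) ^+ 2.
  by apply: sumr_ge0 => z _; apply: sumr_ge0 => w _; rewrite sqr_ge0.
set S := \sum_(z <- s) d z; set D := \sum_(z <- s) d z ^+ 2.
have sum1 c : \sum_(z <- s) c = (size s)%:R * c.
  by rewrite big_const_seq count_predT iter_addr_0 mulr_natl.
rewrite (eq_bigr (fun z => (size s)%:R * d z ^+ 2 - 2 * S * d z + D)); last first.
  move=> z _; rewrite (eq_bigr (fun w => d z ^+ 2 - 2 * d z * d w + d w ^+ 2)).
    by rewrite big_split/= sumrB -!mulr_sumr sum1 -/S -/D; ring.
  by move=> w _; ring.
rewrite big_split/= sumrB -!mulr_sumr sum1 -/S -/D; lra.
Qed.

Lemma telescope_zip (R : realType) (T : Type) (f : T -> R) (x : T) (s : seq T) :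
  \sum_(z <- zip (x :: s) s) (f z.1 - f z.2) = f x - f (last x s).
Proof.
elim: s x => [|y s IH] x; first by rewrite big_nil subrr.
by rewrite [zip _ _]/= big_cons IH/=; ring.
Qed.

(** Taking a path's own consecutive pairs as the relation ensures that a shortened path uses only
    transitions of the original one. *)
Lemma path_mem_zip (T : eqType) (x : T) (s : seq T) :
  path (fun z w => (z, w) \in zip (x :: s) s) x s.
Proof.
elim: s x => [//|y s IH] x; rewrite [zip _ _]/= [path _ _ _]/= mem_head/=.
by apply: sub_path (IH y) => z w h; rewrite inE h orbT.
Qed.

Lemma path_zip_mem (T : eqType) (e : rel T) (x : T) (s : seq T) (z : T * T) :
  path e x s -> z \in zip (x :: s) s -> e z.1 z.2.
Proof.
elim: s x => [//|y s IH] x; rewrite [path _ _ _]/= [zip _ _]/= => /andP[exy ps].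
by rewrite inE => /orP[/eqP -> //|]; exact: IH.
Qed.

(* A path may repeat a transition, while the sum on the right counts it once:
   hence the reduction to a simple path on a subset of the transitions. *)
Lemma sqr_path_le (R : realType) (T : finType) (f : T -> R) (x : T) (s : seq T) :
  (f x - f (last x s)) ^+ 2 <=
  (size s)%:R * \sum_(z : T * T | z \in zip (x :: s) s) (f z.1 - f z.2) ^+ 2.
Proof.
case: (shortenP (path_mem_zip x s)) => s' ps' us' ss'.
rewrite -telescope_zip; apply: le_trans (sqr_sum_le_size _ _) _.
have uz : uniq (zip (x :: s') s').
  by apply: zip_uniqr; case/andP: us'.
have szs' : (size (zip (x :: s') s') <= size s)%N.
  rewrite size_zip/= (minn_idPr _)//; apply: uniq_leq_size => //.
  by case/andP: us'.
apply: ler_pM.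
- by [].
- by apply: sumr_ge0 => z _; rewrite sqr_ge0.
- by rewrite ler_nat.
rewrite big_uniq//= big_mkcond [leRHS]big_mkcond/=.
apply: ler_sum => z _; case: ifP => [zs'|_]; last by case: ifP; rewrite ?sqr_ge0.
by case: z zs' => z1 z2 zs'; rewrite (path_zip_mem ps' zs').
Qed.

Lemma esumZl (R : realType) (T : choiceType) (I : set T) (a : T -> \bar R) (c : R) :
  0 <= c -> (forall i, 0 <= a i)%E ->
  (\esum_(i in I) (c%:E * a i) = c%:E * \esum_(i in I) a i)%E.
Proof.
move=> c0 a0; rewrite /esum -ereal_supZl//; last first.
  by apply/set0P; exists (\sum_(x \in set0) a x)%E, set0 => //; exact: fsets_set0.
rewrite image_comp; congr ereal_sup; apply: eq_imagel => X _ /=.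
by rewrite ge0_mule_fsumr.
Qed.

(** This is the reverse triangle inequality in [L^2(w)] for the functions [f x] and [f y] of a pair;
    the marginals of [w] give their norms [A] and [B]. *)
Lemma coupling_sqrt_le (R : realType) (S : finType) (nu pi : S -> R)
    (w : S -> S -> R) (f : S -> R) :
  (forall x y, 0 <= w x y) ->
  (forall x, \sum_y w x y = nu x) -> (forall y, \sum_x w x y = pi y) ->
  (Num.sqrt (\sum_x nu x * f x ^+ 2) - Num.sqrt (\sum_x pi x * f x ^+ 2)) ^+ 2
    <= \sum_x \sum_y w x y * (f x - f y) ^+ 2.
Proof.
move=> w0 wnu wpi.
have nu0 x : 0 <= nu x by rewrite -wnu sumr_ge0.
have pi0 x : 0 <= pi x by rewrite -wpi sumr_ge0.
have sq0 (r : S -> R) : (forall x, 0 <= r x) -> 0 <= \sum_x r x * f x ^+ 2.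
  by move=> r0; rewrite sumr_ge0// => x _; rewrite mulr_ge0// sqr_ge0.
set A := Num.sqrt _; set B := Num.sqrt _.
have A0 : 0 <= A by exact: sqrtr_ge0.
have B0 : 0 <= B by exact: sqrtr_ge0.
have AE : \sum_x \sum_y w x y * f x ^+ 2 = A ^+ 2.
  rewrite sqr_sqrtr ?sq0//; apply: eq_bigr => x _.
  by rewrite -mulr_suml wnu.
have BE : \sum_x \sum_y w x y * f y ^+ 2 = B ^+ 2.
  rewrite sqr_sqrtr ?sq0// exchange_big; apply: eq_bigr => y _.
  by rewrite -mulr_suml wpi.
pose C := \sum_x \sum_y w x y * (f x * f y).
have expand (s t : R) : \sum_x \sum_y w x y * (s * f x - t * f y) ^+ 2
    = s ^+ 2 * A ^+ 2 - 2 * s * t * C + t ^+ 2 * B ^+ 2.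
  rewrite -AE -BE /C !mulr_sumr -sumrB -big_split/=; apply: eq_bigr => x _.
  rewrite !mulr_sumr -sumrB -big_split/=; apply: eq_bigr => y _; ring.
have pos (s t : R) : 0 <= s ^+ 2 * A ^+ 2 - 2 * s * t * C + t ^+ 2 * B ^+ 2.
  rewrite -expand; apply: sumr_ge0 => x _; apply: sumr_ge0 => y _.
  by rewrite mulr_ge0// sqr_ge0.
have CAB : C <= A * B.
  have zero (r : S -> R) : (forall x, 0 <= r x) ->
      Num.sqrt (\sum_x r x * f x ^+ 2) = 0 -> forall x, r x * f x ^+ 2 = 0.
    move=> r0 /eqP; rewrite sqrtr_eq0 => s0 x.
    have /eqP := le_anti (introT andP (conj s0 (sq0 _ r0))).
    rewrite psumr_eq0 => [/allP/(_ x (mem_index_enum x))/eqP//|y _].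
    by rewrite mulr_ge0// sqr_ge0.
  (* If [A B > 0], the quadratic form at [(s, t) = (B, A)] equals [2 A B (A B - C)]. Otherwise [f]
     vanishes wherever one marginal is positive, so every term of [C] is zero. *)
  have [AB0|] := eqVneq (A * B) 0; last first.
    move=> AB; have {}AB : 0 < A * B by rewrite lt0r AB mulr_ge0.
    suff : 0 <= A * B * (A * B - C) by rewrite pmulr_rge0// subr_ge0.
    by have := pos B A; lra.
  suff -> : C = 0 by rewrite AB0.
  apply: big1 => x _; apply: big1 => y _.
  move/eqP: AB0; rewrite mulf_eq0 => /orP[]/eqP.
    move=> /(zero _ nu0)/(_ x)/eqP; rewrite mulf_eq0 sqrf_eq0 => /orP[/eqP|/eqP ->].
      rewrite -wnu => /eqP; rewrite psumr_eq0// => /allP/(_ y (mem_index_enum y)).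
      by move=> /eqP ->; rewrite mul0r.
    by rewrite mul0r mulr0.
  move=> /(zero _ pi0)/(_ y)/eqP; rewrite mulf_eq0 sqrf_eq0 => /orP[/eqP|/eqP ->].
    rewrite -wpi => /eqP; rewrite psumr_eq0// => /allP/(_ x (mem_index_enum x)).
    by move=> /eqP ->; rewrite mul0r.
  by rewrite !mulr0.
have := expand 1 1.
under eq_bigr do under eq_bigr do rewrite !mul1r.
by move=> ->; lra.
Qed.

(** * Energy estimate for a single transport flow *)

Section TransportFlow.
Variables (R : realType) (S : finType) (Q : S -> S -> R).
Variables (nu pi : S -> R) (G : qpath Q -> R).
Hypothesis flowG : transport_flow nu pi G.

Let G0 g : 0 <= G g. Proof. by case: flowG => -[]. Qed.

(** The joint law of the endpoints of a random path, hence a coupling of [nu] and [pi]. *)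
Let W (x y : S) : \bar R :=
  \esum_(g in [set: qpath Q])
    (if (path_source g == x) && (path_target g == y) then (G g)%:E else 0%E).

Let W_ge0 x y : (0 <= W x y)%E.
Proof. by apply: esum_ge0 => g _; case: ifP => // _; rewrite lee_fin. Qed.

Let W_fin x y : W x y \is a fin_num.
Proof.
rewrite ge0_fin_numE//; apply: le_lt_trans (ltry 1).
case: flowG => -[_ <-] _ _; apply: le_esum => g _.
by case: ifP => // _; rewrite lee_fin.
Qed.

Let W_source x : (\sum_y W x y = (nu x)%:E)%E.
Proof.
rewrite -esum_sum; last by move=> g y _ _; case: ifP => // _; rewrite lee_fin.
case: flowG => _ <- _; rewrite [RHS]esum_mkcond; apply: eq_esum => g _.
rewrite (bigD1 (path_target g))//= eqxx andbT big1 ?adde0; last first.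
  by move=> y; rewrite eq_sym => /negPf ->; rewrite andbF.
by congr (if _ then _ else _); apply/eqP/idP; rewrite inE.
Qed.

Let W_target y : (\sum_x W x y = (pi y)%:E)%E.
Proof.
rewrite -esum_sum; last by move=> g x _ _; case: ifP => // _; rewrite lee_fin.
case: flowG => _ _ <-; rewrite [RHS]esum_mkcond; apply: eq_esum => g _.
rewrite (bigD1 (path_source g))//= eqxx big1 ?adde0; last first.
  by move=> x; rewrite eq_sym => /negPf ->.
by congr (if _ then _ else _); apply/eqP/idP; rewrite inE.
Qed.

(** The coupling bound gives the mean of [(f(source) - f(target))^2]; [sqr_path_le] bounds this on
    each path, and the sum over transitions is exchanged with the expectation. The right side may be
    infinite. *)
Lemma transport_sqrt_le (f : S -> R) :
  (((Num.sqrt (\sum_x nu x * f x ^+ 2)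
     - Num.sqrt (\sum_x pi x * f x ^+ 2)) ^+ 2)%:E
   <= \sum_(z : S * S | transition Q z.1 z.2) ((f z.1 - f z.2) ^+ 2)%:E *
        nnexpect G (fun g => (path_length g)%:R * (traverses z.1 z.2 g)%:R)%R)%E.
Proof.
pose w x y := fine (W x y).
have wE x y : (w x y)%:E = W x y by rewrite fineK.
have w0 x y : 0 <= w x y by exact: fine_ge0.
have wnu x : \sum_y w x y = nu x.
  by apply: EFin_inj; rewrite -sumEFin -W_source; apply: eq_bigr => y _.
have wpi y : \sum_x w x y = pi y.
  by apply: EFin_inj; rewrite -sumEFin -W_target; apply: eq_bigr => x _.
apply: (@le_trans _ _ (\sum_x \sum_y w x y * (f x - f y) ^+ 2)%:E).
  by rewrite lee_fin; exact: coupling_sqrt_le.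
have -> : (\sum_x \sum_y w x y * (f x - f y) ^+ 2)%:E =
    \esum_(g in [set: qpath Q])
      (G g * (f (path_source g) - f (path_target g)) ^+ 2)%:E.
  rewrite pair_bigA/= -sumEFin.
  transitivity (\sum_(z : S * S) \esum_(g in [set: qpath Q])
      (if (path_source g == z.1) && (path_target g == z.2)
       then (G g * (f z.1 - f z.2) ^+ 2)%:E else 0))%E.
    apply: eq_bigr => z _; rewrite EFinM wE muleC -esumZl ?sqr_ge0//; last first.
      by move=> g; case: ifP => // _; rewrite lee_fin.
    apply: eq_esum => g _; case: ifP => _; last by rewrite mule0.
    by rewrite -EFinM mulrC.
  rewrite -esum_sum; last first.
    by move=> g z _ _; case: ifP => // _; rewrite lee_fin mulr_ge0// sqr_ge0.
  apply: eq_esum => g _.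
  rewrite (bigD1 (path_source g, path_target g))//= !eqxx/= big1 ?adde0//.
  by case=> x y; rewrite xpair_eqE eq_sym [y == _]eq_sym => /negPf ->.
have X0 g z : 0 <= G g * ((path_length g)%:R * (traverses z.1 z.2 g)%:R).
  by rewrite !mulr_ge0.
rewrite (eq_bigr (fun z => \esum_(g in [set: qpath Q])
    (((f z.1 - f z.2) ^+ 2)%:E *
     (G g * ((path_length g)%:R * (traverses z.1 z.2 g)%:R))%:E))%E); last first.
  by move=> z _; rewrite esumZl ?sqr_ge0// => g; rewrite lee_fin X0.
rewrite -esum_sum; last by move=> g z _ _; rewrite -EFinM lee_fin mulr_ge0 ?sqr_ge0.
apply: le_esum => g _; rewrite sumEFin lee_fin.
rewrite (eq_bigr (fun z => G g * ((path_length g)%:R *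
    ((traverses z.1 z.2 g)%:R * (f z.1 - f z.2) ^+ 2)))); last first.
  by move=> z _; ring.
rewrite -mulr_sumr ler_wpM2l// -mulr_sumr.
apply: le_trans (sqr_path_le _ _ _) _; rewrite ler_wpM2l//.
rewrite big_mkcond [leRHS]big_mkcond; apply: ler_sum => z _.
rewrite /traverses -surjective_pairing.
case: ifP => [zg|_]; last by case: ifP => // _; rewrite mul0r.
(* Every consecutive pair of a [qpath] is a transition, so restricting the sum to transitions loses
   nothing. *)
by rewrite (path_zip_mem (valP g) zg) mul1r.
Qed.
End TransportFlow.

(** * Marginals, conditional entropies and the use of congestion *)

Section Marginals.
Variables (R : realType) (E : finType) (q : nat) (mu : config E q -> R).
Hypothesis hmu : is_fdist mu.

Let mu0 x : 0 <= mu x. Proof. by case: hmu. Qed.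

Lemma sum_Omega (P : pred (config E q)) (h : config E q -> R) :
  \sum_(x : Omega mu | P (val x)) mu (val x) * h (val x)
  = \sum_(x | P x) mu x * h x.
Proof.
rewrite [RHS](bigID (supp mu))/= [X in _ + X]big1 ?addr0; last first.
  by move=> x /andP[_ /negPn/eqP ->]; rewrite mul0r.
rewrite -(big_sub_cond (supp mu) P (fun x => mu x * h x))/=.
by apply: eq_bigl => x; rewrite andbC.
Qed.

Lemma fdist_Omega : is_fdist (fun x : Omega mu => mu (val x)).
Proof.
split=> [x|]; first exact: mu0.
have := sum_Omega predT (fun=> 1).
under eq_bigr do rewrite mulr1.
by move=> ->; under eq_bigr do rewrite mulr1; case: hmu.
Qed.

Let sum_mu : \sum_(x : Omega mu) mu (val x) = 1.
Proof. exact: (proj2 fdist_Omega). Qed.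

Lemma marginal_ge0 e c : 0 <= marginal mu e c.
Proof. by apply: sumr_ge0 => x _; exact: mu0. Qed.

Lemma marginal_coord_gt0 e (x : Omega mu) : 0 < marginal mu e (val x e).
Proof.
have mx : 0 < mu (val x) by rewrite lt0r mu0 andbT; exact: (valP x).
apply: lt_le_trans mx _; rewrite /marginal (bigD1 (val x))//= lerDl.
by apply: sumr_ge0.
Qed.

Lemma sum_coord (e : E) (h : 'I_q -> R) :
  \sum_(x : Omega mu) mu (val x) * h (val x e) = \sum_c marginal mu e c * h c.
Proof.
rewrite (sum_Omega predT (fun x => h (x e))).
rewrite (partition_big (fun x : config E q => x e) predT)//=.
apply: eq_bigr => c _; rewrite /marginal mulr_suml.
by apply: eq_bigr => x /eqP ->.
Qed.

Lemma sum_marginal e : \sum_c marginal mu e c = 1.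
Proof.
have := sum_coord e (fun=> 1); under [RHS]eq_bigr do rewrite mulr1.
move=> <-; rewrite -[RHS]sum_mu.
by apply: eq_bigr => x _; rewrite mulr1.
Qed.

Lemma cond_expectE e (G : Omega mu -> R) x :
  cond_expect e G x = \sum_y pin e (val x e) y * G y.
Proof.
rewrite /cond_expect mulr_suml big_mkcond; apply: eq_bigr => y _.
by rewrite /pin; case: ifP => _; rewrite ?mul0r// mulrAC.
Qed.

(** Two values of the coordinate would carry mass above 1, so [X_e] is constant on the support and
    so is the conditional expectation. *)
Lemma Ent_cond_expect_atom (e : E) (G : Omega mu -> R) (phi : R) : 2^-1 < phi ->
  (forall c, marginal mu e c != 0 -> phi <= marginal mu e c) ->
  Ent (cond_expect e G) = 0.
Proof.
move=> hp hphi.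
have coord (x y : Omega mu) : val x e = val y e.
  apply/eqP/negPn/negP => xy; have := sum_marginal e.
  rewrite (bigD1 (val x e))//= (bigD1 (val y e)) 1?eq_sym//= => s.
  have := hphi _ (lt0r_neq0 (marginal_coord_gt0 e x)).
  have := hphi _ (lt0r_neq0 (marginal_coord_gt0 e y)).
  have : 0 <= \sum_(i | (i != val x e) && (i != val y e)) marginal mu e i.
    by apply: sumr_ge0 => c _; exact: marginal_ge0.
  by move: s; lra.
have ce x y : cond_expect e G x = cond_expect e G y.
  by rewrite !cond_expectE (coord x y).
have Ec (c : R) : expect (fun _ : Omega mu => c) = c.
  by rewrite /expect -mulr_suml sum_mu mul1r.
have [x _] : exists2 x : Omega mu, true & true.
  case: (pickP (fun _ : Omega mu => true)) => [x _|none]; first by exists x.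
  have := sum_mu; rewrite big_pred0// => /eqP.
  by rewrite eq_sym oner_eq0.
have -> : cond_expect e G = fun=> cond_expect e G x by apply/funext => y.
by rewrite /Ent !Ec subrr.
Qed.

Lemma Ent_cond_expect_le (e : E) (f : Omega mu -> R) (phi : R) : 0 < phi <= 2^-1 ->
  (forall c, marginal mu e c != 0 -> phi <= marginal mu e c) ->
  Ent (cond_expect e (fun x => f x ^+ 2)) <= 2 / lsi_ratio phi *
   \sum_(a : 'I_q) \sum_(b : 'I_q | (a < b)%N) marginal mu e a * marginal mu e b *
    (Num.sqrt (\sum_x pin e a x * f x ^+ 2)
      - Num.sqrt (\sum_x pin e b x * f x ^+ 2)) ^+ 2.
Proof.
move=> hp hphi.
pose v c := Num.sqrt (\sum_(x : Omega mu) pin e c x * f x ^+ 2).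
have pin0 c (x : Omega mu) : 0 <= pin e c x.
  by rewrite /pin; case: ifP => // _; rewrite divr_ge0 ?mu0 ?marginal_ge0.
have v2E : \sum_c marginal mu e c * v c ^+ 2
    = \sum_(x : Omega mu) mu (val x) * v (val x e) ^+ 2.
  by rewrite (sum_coord e (fun c => v c ^+ 2)).
rewrite -(variance_pairs v (sum_marginal e)) v2E -(sum_coord e v).
have ceE x : cond_expect e (fun x => f x ^+ 2) x = v (val x e) ^+ 2.
  rewrite cond_expectE sqr_sqrtr// sumr_ge0// => y _.
  by rewrite mulr_ge0 ?sqr_ge0.
rewrite /Ent /expect; under eq_bigr do rewrite ceE.
under [X in X * ln _]eq_bigr do rewrite ceE.
under [X in _ * ln X]eq_bigr do rewrite ceE.
apply: (entropy_sqr_le_variance (p := fun x : Omega mu => mu (val x))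
  (u := fun x => v (val x e))) => //.
  by move=> x; exact: sqrtr_ge0.
(* The term [c = x e] alone already makes the mean of [v] at least [phi * v (x e)]. *)
move=> x; rewrite sum_coord (bigD1 (val x e))//=.
rewrite -[leLHS]addr0 lerD//.
  by rewrite ler_wpM2r ?sqrtr_ge0// hphi// lt0r_neq0// marginal_coord_gt0.
by apply: sumr_ge0 => c _; rewrite mulr_ge0 ?marginal_ge0 ?sqrtr_ge0.
Qed.

Lemma sum_lt_pairs_le (n : nat) (c : R) : 0 <= c ->
  2 * \sum_(a : 'I_n) \sum_(b : 'I_n | (a < b)%N) c <= n%:R ^+ 2 * c.
Proof.
move=> c0.
have -> : n%:R ^+ 2 * c = \sum_(a : 'I_n) \sum_(b : 'I_n) c.
  by rewrite !sumr_const card_ord -mulrnA -[RHS]mulr_natl natrM expr2.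
rewrite mulr2n mulrDl mul1r {2}(exchange_big_dep predT)//= -big_split/=.
apply: ler_sum => a _; rewrite [leRHS](bigID (fun b : 'I_n => (a < b)%N))/= lerD2l.
rewrite big_mkcond [leRHS]big_mkcond; apply: ler_sum => b _.
by rewrite -leqNgt; case: ltnP => [/ltnW ->//|_]; case: ifP.
Qed.

(** Congestion is assumed for each pair [a < b] separately, so the sum over [e] is taken innermost;
    each pair then costs [2 kappa] times the Dirichlet form, and there are at most [q^2 / 2]
    pairs. *)
Lemma local_variance_le (Q : Omega mu -> Omega mu -> R) (kappa : R)
    (G : E -> 'I_q -> 'I_q -> qpath Q -> R) (f : Omega mu -> R) :
  0 <= kappa -> reversible_chain Q -> transport_flow_family G ->
  strong_expected_congestion G kappa ->
  \sum_(e : E) \sum_(a : 'I_q) \sum_(b : 'I_q | (a < b)%N)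
    marginal mu e a * marginal mu e b *
    (Num.sqrt (\sum_x pin e a x * f x ^+ 2)
      - Num.sqrt (\sum_x pin e b x * f x ^+ 2)) ^+ 2
  <= q%:R ^+ 2 * kappa * dirichlet Q f.
Proof.
move=> k0 [Q0 _ _] flowG congG.
pose tr (z : Omega mu * Omega mu) := transition Q z.1 z.2.
have D0 : 0 <= \sum_(x : Omega mu) \sum_(y : Omega mu)
    mu (val x) * Q x y * (f x - f y) ^+ 2.
  apply: sumr_ge0 => x _; apply: sumr_ge0 => y _.
  by rewrite mulr_ge0 ?sqr_ge0// mulr_ge0.
rewrite exchange_big/=.
under eq_bigr do rewrite exchange_big/=.
apply: (@le_trans _ _ (\sum_(a : 'I_q) \sum_(b : 'I_q | (a < b)%N)
    2 * kappa * dirichlet Q f)); last first.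
  have h0 : 0 <= 2 * kappa * dirichlet Q f.
    by rewrite /dirichlet !mulr_ge0// invr_ge0.
  have := sum_lt_pairs_le q h0.
  by move: (q%:R ^+ 2) (dirichlet Q f) (\sum_(a : 'I_q) _) => n D s; lra.
apply: ler_sum => a _; apply: ler_sum => b ab.
rewrite -lee_fin.
set v := fun (e : E) (c : 'I_q) => Num.sqrt (\sum_x pin e c x * f x ^+ 2).
(* Coordinates where [a] or [b] has zero mass carry zero weight, and no flow is available there. *)
rewrite (bigID (fun e => supp (marginal mu e) a && supp (marginal mu e) b))/=.
rewrite [X in _ + X]big1 ?addr0; last first.
  move=> e; rewrite negb_and => /orP[] /negPn/eqP ->; first by rewrite !mul0r.
  by rewrite mulr0 mul0r.
pose N e (z : Omega mu * Omega mu) := nnexpect (G e a b)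
  (fun g => (path_length g)%:R * (traverses z.1 z.2 g)%:R).
have N0 e z : supp (marginal mu e) a && supp (marginal mu e) b -> (0 <= N e z)%E.
  move=> /andP[sa sb]; apply: esum_ge0 => g _; rewrite lee_fin !mulr_ge0//.
  by case: (flowG e a b sa sb ab) => -[].
rewrite -sumEFin.
apply: (@le_trans _ _ (\sum_(e | supp (marginal mu e) a && supp (marginal mu e) b)
    \sum_(z | tr z) ((f z.1 - f z.2) ^+ 2)%:E *
      ((marginal mu e a * marginal mu e b)%:E * N e z)))%E.
  apply: lee_sum => e sab; have /andP[sa sb] := sab.
  rewrite EFinM (eq_bigr (fun z => (marginal mu e a * marginal mu e b)%:E *
    (((f z.1 - f z.2) ^+ 2)%:E * N e z))%E); last by move=> z _; rewrite muleCA.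
  rewrite -ge0_sume_distrr; last first.
    by move=> z _; rewrite mule_ge0 ?N0// lee_fin sqr_ge0.
  rewrite lee_wpmul2l ?lee_fin ?mulr_ge0 ?marginal_ge0//.
  exact: transport_sqrt_le (flowG e a b sa sb ab) f.
rewrite exchange_big/=.
apply: (@le_trans _ _ (\sum_(z | tr z)
    ((f z.1 - f z.2) ^+ 2 * (kappa * mu (val z.1) * Q z.1 z.2))%:E))%E.
  apply: lee_sum => z trz; rewrite -ge0_sume_distrr; last first.
    by move=> e sab; rewrite mule_ge0 ?N0// lee_fin mulr_ge0 ?marginal_ge0.
  by rewrite [leRHS]EFinM lee_wpmul2l ?lee_fin ?sqr_ge0//; exact: congG.
(* The 2 cancels the [1/2] of the Dirichlet form; pairs that are not transitions only add
   nonnegative terms on the right. *)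
rewrite sumEFin lee_fin /dirichlet mulrA [2 * _ * _]mulrAC divff// mul1r.
rewrite pair_bigA/= mulr_sumr big_mkcond; apply: ler_sum => z _.
case: ifP => _; last by rewrite (mulr_ge0 k0)// mulr_ge0 ?sqr_ge0// mulr_ge0.
by rewrite le_eqVlt; apply/orP; left; apply/eqP; ring.
Qed.

End Marginals.

(** * Assembly of the constants *)

Theorem theorem2p9 (R : realType) (E : finType) (q : nat) (kappa : R)
    (hkappa : 0 < kappa)
    (mu : config E q -> R) (hmu : is_fdist mu)
    (Q : Omega mu -> Omega mu -> R) (hQ : reversible_chain Q)
    (hflow : exists G : E -> 'I_q -> 'I_q -> qpath Q -> R,
       transport_flow_family G /\ strong_expected_congestion G kappa)
    (phi : R) (hphi0 : 0 < phi)
    (hphi : forall (e : E) (c : 'I_q),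
       marginal mu e c != 0 -> phi <= marginal mu e c) :
  local_log_sobolev Q ((2 * q%:R ^+ 2 * kappa)^-1 * lsi_ratio phi).
Proof.
move=> f.
have D0 : 0 <= dirichlet Q f.
  have [Q0 _ _] := hQ; have [mu0 _] := hmu.
  rewrite mulr_ge0 ?invr_ge0//; apply: sumr_ge0 => x _; apply: sumr_ge0 => y _.
  by rewrite mulr_ge0 ?sqr_ge0// mulr_ge0.
have [phi2|phi2] := leP phi 2^-1; last first.
  by rewrite big1 ?mulr0// => e _; exact: Ent_cond_expect_atom phi2 (hphi e).
have hp : 0 < phi <= 2^-1 by rewrite hphi0.
(* For [q = 0] the inverse of 0 is 0, so the constant is 0. *)
have [->|q0] := eqVneq q%:R (0 : R).
  by rewrite expr0n/= mulr0 mul0r invr0 !mul0r.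
have q2 : 0 < q%:R ^+ 2 :> R by rewrite exprn_even_gt0.
have l0 : 0 < lsi_ratio phi.
  by rewrite -invr_gt0; apply: lt_le_trans (lsi_ratio_inv_ge2 hp).
have [G [flowG congG]] := hflow.
have Vle := local_variance_le hmu f (ltW hkappa) hQ flowG congG.
have Ele := ler_sum (index_enum E)
  (fun e (_ : true) => Ent_cond_expect_le hmu f hp (hphi e)).
rewrite -mulr_sumr in Ele.
have a0 : 0 <= (2 * q%:R ^+ 2 * kappa)^-1 * lsi_ratio phi.
  by rewrite mulr_ge0 ?(ltW l0)// invr_ge0 !mulr_ge0// ?(ltW q2)// ltW.
apply: le_trans (ler_wpM2l a0 Ele) _.
(* The factor 2 lost in the entropy bound cancels the 2 in the denominator of [alpha], leaving
   [1 / (q^2 kappa)]. *)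
have -> (W : R) : (2 * q%:R ^+ 2 * kappa)^-1 * lsi_ratio phi * (2 / lsi_ratio phi * W)
   = W / (q%:R ^+ 2 * kappa).
  by field; rewrite q0 !gt_eqF.
rewrite ler_pdivrMr; last exact: mulr_gt0.
by rewrite mulrC.
Qed.
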